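(* Consider the problem $\Psi^*=\min_{x\in X}\{\Psi(x)=f(x)+\mathcal{X}(x)\}$, where $f$ has $L$-Lipschitz continuous gradient on $X$, and suppose that in the UAG algorithm (described in the context) the parameters are set to $$\alpha_k=\frac{2}{k+1},\qquad \lambda_k=\frac{k}{2L},\qquad \beta_k=\frac1L\qquad (k\ge1).$$ (a) Suppose that $\Psi$ is bounded below over $X$, i.e., $\Psi^*$ is finite. Then for any $N\ge1$, we have $$\min_{k=1,\ldots,N}\|g_{X,k}\|^2\le\frac{2L[\Psi(x_0)-\Psi^*]}{N}.$$ (b) Suppose that $f$ is convex and an optimal solution $x^*$ exists for the problem $\min_{x\in X}\Psi(x)$. Then for any $N\ge1$, we have $$\Psi(x^{ag}_N)-\Psi(x^* )\le\frac{2L\|x_0-x^*\|^2}{N(N+1)}.$$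
   Context: Setting: $X\subseteq\mathbb{R}^n$ is a closed convex set, $f:X\to\mathbb{R}$ is differentiable and possibly nonconvex, $\mathcal{X}$ is a (possibly nondifferentiable) convex real-valued function on $X$, $\Psi:=f+\mathcal{X}$, and $\Psi^*:=\min_{x\in X}\Psi(x)$ denotes the optimal value (infimum). $\|\cdot\|$ is the Euclidean norm and $f'$ is the gradient of $f$. There is $L>0$ with $\|f'(y)-f'(x)\|\le L\|y-x\|$ for all $x,y\in X$. UAG algorithm. Input: $x_0\in X$; $\{\alpha_k\}_{k\ge1}$ with $\alpha_1=1$ and $\alpha_k\in(0,1)$ for $k\ge2$; sequences $\lambda_k>0$, $\beta_k>0$. Set $x^{ag}_0=x_0$. For $k=1,2,\ldots$: 1. $x^{md}_k=(1-\alpha_k)x^{ag}_{k-1}+\alpha_k x_{k-1}$. 2. Set $x_k=\arg\min_{u\in X}\{\langle f'(x^{md}_k),u\rangle+\frac{1}{2\lambda_k}\|u-x_{k-1}\|^2+\mathcal{X}(u)\}$, $\tilde x^{ag}_k=(1-\alpha_k)x^{ag}_{k-1}+\alpha_k x_k$, $\bar x^{ag}_k=\arg\min_{u\in X}\{\langle f'(x^{ag}_{k-1}),u\rangle+\frac{1}{2\beta_k}\|u-x^{ag}_{k-1}\|^2+\mathcal{X}(u)\}$ (the minimizers in these subproblems are assumed to exist). 3. Choose $x^{ag}_k\in\{\bar x^{ag}_k,\tilde x^{ag}_k\}$ such that $\Psi(x^{ag}_k)=\min\{\Psi(\bar x^{ag}_k),\Psi(\tilde x^{ag}_k)\}$.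 The generalized projected gradient is $g_{X,k}:=(x^{ag}_{k-1}-\bar x^{ag}_k)/\beta_k$. *)

(* Defs.v *)
From HB Require Import structures.
From mathcomp Require Import all_boot all_order all_algebra.
From mathcomp Require Import all_classical all_reals all_analysis.

Set Implicit Arguments.
Unset Strict Implicit.
Unset Printing Implicit Defensive.

Import Order.TTheory GRing.Theory Num.Theory.
Import numFieldNormedType.Exports.

Local Open Scope classical_set_scope.
Local Open Scope ring_scope.

Definition dot (R : realType) (n : nat) (u v : 'rV[R]_n) : R :=
  \sum_(i < n) u 0 i * v 0 i.

(* The library norm on 'rV[R]_n is the sup norm, so it cannot be used here. *)
Definition enorm (R : realType) (n : nat) (u : 'rV[R]_n) : R :=
  Num.sqrt (dot u u).

(* Fréchet differentiability relative to X: only the values of f on X matter,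
   and X is allowed to have boundary points or empty interior. At interior
   points g x is the usual gradient. If X spans a proper affine subspace, g x
   is determined only up to a vector orthogonal to it; any choice is allowed. *)
Definition is_gradient_on (R : realType) (n : nat) (X : set 'rV[R]_n)
    (f : 'rV[R]_n -> R) (g : 'rV[R]_n -> 'rV[R]_n) : Prop :=
  forall x : 'rV[R]_n, X x -> let F := within X (nbhs x) in
    (fun y : 'rV[R]_n => f y - f x - dot (g x) (y - x) : R^o)
      =o_F (fun y : 'rV[R]_n => enorm (y - x) : R^o).

Definition enorm_lipschitz_on (R : realType) (n : nat) (X : set 'rV[R]_n) (L : R)
    (g : 'rV[R]_n -> 'rV[R]_n) : Prop :=
  forall x y : 'rV[R]_n, X x -> X y -> enorm (g y - g x) <= L * enorm (y - x).

Definition is_argmin (T : Type) (R : realType) (X : set T) (F : T -> R)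
    (u : T) : Prop :=
  X u /\ forall v : T, X v -> F u <= F v.

(* Objective of the proximal subproblem with slope p, step size c and center
   x; h is the possibly nonsmooth convex term. *)
Definition prox_obj (R : realType) (n : nat) (h : 'rV[R]_n -> R)
    (p : 'rV[R]_n) (c : R) (x u : 'rV[R]_n) : R :=
  dot p u + 1 / (2 * c) * enorm (u - x) ^+ 2 + h u.

(* x, xag, xmd, xtil, xbar form a run of the UAG algorithm on f + h with
   gradient map f'. Only the indices k >= 1 of xmd, xtil, xbar and of the
   parameter sequences are meaningful. *)
Record is_UAG (R : realType) (n : nat) (X : set 'rV[R]_n)
    (f : 'rV[R]_n -> R) (f' : 'rV[R]_n -> 'rV[R]_n) (h : 'rV[R]_n -> R)
    (x0 : 'rV[R]_n) (alpha lam beta : nat -> R)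
    (x xag xmd xtil xbar : nat -> 'rV[R]_n) : Prop := IsUAG {
  uag_x0_in : X x0;
  uag_alpha1 : alpha 1%N = 1;
  uag_alpha : forall k : nat, (2 <= k)%N -> 0 < alpha k < 1;
  uag_lam : forall k : nat, (1 <= k)%N -> 0 < lam k;
  uag_beta : forall k : nat, (1 <= k)%N -> 0 < beta k;
  uag_init : x 0%N = x0;
  uag_init_ag : xag 0%N = x0;
  uag_md : forall k : nat, (1 <= k)%N ->
    xmd k = (1 - alpha k) *: xag k.-1 + alpha k *: x k.-1;
  uag_x : forall k : nat, (1 <= k)%N ->
    is_argmin X (prox_obj h (f' (xmd k)) (lam k) (x k.-1)) (x k);
  uag_til : forall k : nat, (1 <= k)%N ->
    xtil k = (1 - alpha k) *: xag k.-1 + alpha k *: x k;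
  uag_bar : forall k : nat, (1 <= k)%N ->
    is_argmin X (prox_obj h (f' (xag k.-1)) (beta k) (xag k.-1)) (xbar k);
  uag_choice : forall k : nat, (1 <= k)%N ->
    xag k = xbar k \/ xag k = xtil k;
  uag_choice_min : forall k : nat, (1 <= k)%N ->
    f (xag k) + h (xag k) =
      Num.min (f (xbar k) + h (xbar k)) (f (xtil k) + h (xtil k))
}.

Definition gen_proj_grad (R : realType) (n : nat) (beta : nat -> R)
    (xag xbar : nat -> 'rV[R]_n) (k : nat) : 'rV[R]_n :=
  (beta k)^-1 *: (xag k.-1 - xbar k).

(* Main.v *)
(* With beta_k = 1/L, the descent lemma and the three-point inequality of the
   proximal step give Psi(xag_k) <= Psi(xag_{k-1}) - |g_{X,k}|^2 / (2L);
   telescoping yields (a). For (b), the descent lemma between xmd_k and xtil_k,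
   the gradient inequality for f at xmd_k, and the three-point inequality at the
   optimal point xs make the potential
     k (k + 1) (Psi(xag_k) - Psi(xs)) + 2 L |x_k - xs|^2
   nonincreasing in k. *)
Require Import Defs.
From HB Require Import structures.
From mathcomp Require Import all_boot all_order all_algebra.
From mathcomp Require Import all_classical all_reals all_analysis.
From mathcomp Require Import ring lra.

Import Order.TTheory GRing.Theory Num.Theory.
Import numFieldNormedType.Exports.

Local Open Scope classical_set_scope.
Local Open Scope ring_scope.

Section Euclidean.
Context {R : realType} {n : nat}.
Implicit Types u v w : 'rV[R]_n.

(** * Euclidean inner product and norm *)

Lemma dotC u v : dot u v = dot v u.
Proof. by apply: eq_bigr => i _; rewrite mulrC. Qed.

Lemma dotDl u v w : dot (u + v) w = dot u w + dot v w.
Proof. by rewrite -big_split /=; apply: eq_bigr => i _; rewrite mxE mulrDl. Qed.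

Lemma dotZl (a : R) u v : dot (a *: u) v = a * dot u v.
Proof. by rewrite mulr_sumr; apply: eq_bigr => i _; rewrite mxE mulrA. Qed.

Lemma dotNl u v : dot (- u) v = - dot u v.
Proof. by rewrite -scaleN1r dotZl mulN1r. Qed.

Lemma dotDr u v w : dot u (v + w) = dot u v + dot u w.
Proof. by rewrite dotC dotDl !(dotC _ u). Qed.

Lemma dotZr (a : R) u v : dot u (a *: v) = a * dot u v.
Proof. by rewrite dotC dotZl dotC. Qed.

Lemma dotNr u v : dot u (- v) = - dot u v.
Proof. by rewrite dotC dotNl dotC. Qed.

Lemma dot_ge0 u : 0 <= dot u u.
Proof. by apply: sumr_ge0 => i _; rewrite -expr2 sqr_ge0. Qed.

Lemma enorm_ge0 u : 0 <= enorm u.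
Proof. exact: sqrtr_ge0. Qed.

Lemma enorm2E u : enorm u ^+ 2 = dot u u.
Proof. by rewrite sqr_sqrtr // dot_ge0. Qed.

Lemma enormZ (a : R) u : enorm (a *: u) = `|a| * enorm u.
Proof.
by rewrite /enorm dotZl dotZr mulrA -expr2 sqrtrM ?sqr_ge0// sqrtr_sqr.
Qed.

Lemma enormB u v : enorm (u - v) = enorm (v - u).
Proof. by rewrite /enorm -opprB dotNl dotNr opprK. Qed.

(* Cauchy-Schwarz in the only form needed: expand |u - c v|^2 >= 0. *)
Lemma dot_le_sqr (c : R) u v :
  0 < c -> enorm u <= c * enorm v -> dot u v <= c * enorm v ^+ 2.
Proof.
move=> c0 uv; have uv2 : enorm u ^+ 2 <= (c * enorm v) ^+ 2.
  by rewrite ler_pXn2r// nnegrE ?mulr_ge0 ?enorm_ge0// ltW.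
have := dot_ge0 (u - c *: v).
rewrite exprMn !enorm2E in uv2 *.
rewrite dotDl !dotDr !dotNl !dotNr !dotZl !dotZr (dotC v u) => uv0.
by rewrite -(ler_pM2l c0); nra.
Qed.

(** * Segments, convexity and the three-point inequality *)

Definition segment u v (t : R) := u + t *: (v - u).

Lemma segmentE u v t : segment u v t = (1 - t) *: u + t *: v.
Proof. by rewrite /segment scalerBr scalerBl scale1r addrA addrAC. Qed.

Lemma segment0 u v : segment u v 0 = u.
Proof. by rewrite /segment scale0r addr0. Qed.

Lemma segment1 u v : segment u v 1 = v.
Proof. by rewrite /segment scale1r addrC subrK. Qed.

Lemma segmentB u v s t : segment u v s - segment u v t = (s - t) *: (v - u).
Proof. by rewrite /segment opprD addrACA subrr add0r -scalerBl. Qed.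

Lemma convex_set_segment (X : set 'rV[R]_n) : convex_set X ->
  forall u v t, X u -> X v -> 0 <= t <= 1 -> X (segment u v t).
Proof.
move=> cX u v t Xu Xv /andP[t0 t1]; rewrite segmentE addrC.
have /(_ (mem_set Xv) (mem_set Xu)) := cX v u (Itv01 t0 t1).
by rewrite inE.
Qed.

Lemma convex_function_segment (X : set 'rV[R]_n) (h : 'rV[R]_n -> R) :
  convex_function X h ->
  forall u v t, X u -> X v -> 0 <= t <= 1 ->
  h (segment u v t) <= (1 - t) * h u + t * h v.
Proof.
move=> ch u v t Xu Xv /andP[t0 t1]; rewrite segmentE addrC [leRHS]addrC.
exact: (ch (Itv01 t0 t1) v u (mem_set Xv) (mem_set Xu)).
Qed.

Lemma dot_segment w u v z t :
  dot w (segment u v t - z) = (1 - t) * dot w (u - z) + t * dot w (v - z).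
Proof.
rewrite /segment !(dotDr, dotNr, dotZr); ring.
Qed.

(** Strong convexity of the squared distance, as an identity; its last term is the source of the
    extra quadratic in [prox_three_point]. *)
Lemma sqr_enorm_segment u v z t :
  enorm (segment u v t - z) ^+ 2 =
  (1 - t) * enorm (u - z) ^+ 2 + t * enorm (v - z) ^+ 2
  - t * (1 - t) * enorm (v - u) ^+ 2.
Proof.
rewrite !enorm2E /segment !(dotDl, dotNl, dotZl) !(dotDr, dotNr, dotZr).
rewrite (dotC v u) (dotC z u) (dotC z v); ring.
Qed.

(** The limit of [t] to 0 done by hand: for [c <= 0] the value [t = 1] suffices, and for [c > 0] the
    choice [t = e / (c + e)] costs [t * c <= e]. *)
Lemma ler_add_vanishing (a b c : R) :
  (forall t, 0 < t <= 1 -> a + (1 - t) * c <= b) -> a + c <= b.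
Proof.
move=> H; apply/ler_addgt0Pr => e e0.
have [c0|c0] := leP c 0.
  have := H 1; rewrite subrr mul0r addr0 ltr01 lexx => /(_ isT) ab.
  lra.
have d0 : 0 < c + e by lra.
have t01 : 0 < e / (c + e) <= 1.
  by rewrite divr_gt0// ler_pdivrMr// mul1r lerDr ltW.
apply: le_trans (lerD (H _ t01) (lexx e)).
have : e / (c + e) * c <= e.
  rewrite mulrAC ler_pdivrMr//; nra.
lra.
Qed.

(* Compare u with the points of the segment from u to v near u: the quadratic
   term of the objective supplies the extra |v - u|^2. *)
Lemma prox_three_point (X : set 'rV[R]_n) (h : 'rV[R]_n -> R) p (c : R) z u v :
  convex_set X -> convex_function X h ->
  is_argmin X (prox_obj h p c z) u -> X v ->
  prox_obj h p c z u + 1 / (2 * c) * enorm (v - u) ^+ 2 <= prox_obj h p c z v.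
Proof.
move=> cX ch [Xu umin] Xv; apply: ler_add_vanishing => t /andP[t0 t1].
have t01 : 0 <= t <= 1 by rewrite (ltW t0).
have := umin _ (convex_set_segment _ cX _ _ _ Xu Xv t01).
have := convex_function_segment _ _ ch _ _ _ Xu Xv t01.
rewrite /prox_obj sqr_enorm_segment.
have -> : dot p (segment u v t) = (1 - t) * dot p u + t * dot p v.
  by rewrite -[segment _ _ _]subr0 dot_segment !subr0.
move=> h1 h2; rewrite -(ler_pM2l t0).
lra.
Qed.

(** * Calculus along segments of [X] *)

(** Pulls the relative expansion of [f] back to the parameter. The restriction of [s] to [0, 1]
    keeps the point in [X], where the expansion is valid. *)
Lemma gradient_segment (X : set 'rV[R]_n) (f : 'rV[R]_n -> R)
    (g : 'rV[R]_n -> 'rV[R]_n) :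
  convex_set X -> is_gradient_on X f g ->
  forall u v (t : R), X u -> X v -> 0 <= t <= 1 -> forall e : R, 0 < e ->
  \forall s \near t, 0 <= s <= 1 ->
    `|f (segment u v s) - f (segment u v t)
      - (s - t) * dot (g (segment u v t)) (v - u)| <= e * `|s - t|.
Proof.
move=> cX gX u v t Xu Xv t01 e e0.
have Xt := convex_set_segment _ cX _ _ _ Xu Xv t01.
(* The remainder is measured by [|s - t| * enorm (v - u)], hence this scaling of [e]; the added 1
   covers [u = v]. *)
have d0 : 0 < e / (1 + enorm (v - u)).
  by rewrite divr_gt0// ltr_pwDl// enorm_ge0.
have /eqoP/(_ _ d0) := gX _ Xt.
rewrite near_withinE => W.
have cs : segment u v @ t --> segment u v t.
  apply: cvgD; first exact: cvg_cst.
  by apply: cvgZr_tmp; exact: cvg_id.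
have {}W : \forall s \near t, X (segment u v s) -> _ := cs _ W.
apply: filterS W => s Ws s01.
have /= := Ws (convex_set_segment _ cX _ _ _ Xu Xv s01).
rewrite segmentB dotZr => /le_trans; apply.
rewrite enormZ ger0_norm ?mulr_ge0 ?enorm_ge0// mulrCA mulrC ler_wpM2r//.
have D0 := enorm_ge0 (v - u).
by rewrite mulrAC ler_pdivrMr ?ltr_pwDl//; nra.
Qed.

Lemma near_dist_le (t e : R) : 0 < e -> \forall s \near t, `|t - s| <= e.
Proof.
move=> e0; apply: filterS (nbhsx_ballx t e e0) => s.
by rewrite /ball /= => /ltW.
Qed.

(* The expansion is only relative to [0, 1]: phi need not be continuous at the
   endpoints from outside, as f carries no hypothesis outside X. *)
Lemma relative_MVT (phi D : R -> R) :
  (forall t : R, 0 <= t <= 1 -> forall e : R, 0 < e ->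
    \forall s \near t, 0 <= s <= 1 ->
      `|phi s - phi t - (s - t) * D t| <= e * `|s - t|) ->
  exists2 c, 0 < c < 1 & phi 1 - phi 0 = D c.
Proof.
move=> Dphi.
have [||c c01 ->] := @MVT R phi D 0 1 ltr01; last 1 first.
- by exists c; [move: c01; rewrite in_itv|rewrite subr0 mulr1].
- move=> t; rewrite in_itv /= => /andP[t0 t1].
  have t01 : 0 <= t <= 1 by rewrite !ltW.
  (* At an interior [t] every nearby [s] lies in [0, 1], so the relative expansion is a genuine
     two-sided derivative. *)
  have Q : (fun h : R => h^-1 *: (phi (h *: 1 + t) - phi t)) @ 0^' --> D t.
    apply/cvgrPdist_le => e e0; rewrite near_withinE.
    have ct : (fun h : R => h + t) @ (0 : R) --> t.
      rewrite -[X in _ --> X]add0r.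
      by apply: cvgD; [exact: cvg_id|exact: cvg_cst].
    have W1 : \forall h \near (0 : R), 0 <= h + t <= 1 ->
      `|phi (h + t) - phi t - (h + t - t) * D t| <= e * `|h + t - t| :=
      ct _ (Dphi t t01 e e0).
    have W2 : \forall s \near t, 0 <= s <= 1.
      have I : t \in `]0, 1[ by rewrite in_itv /= t0.
      apply: filterS (near_in_itvoo I) => s; rewrite in_itv /=.
      by move=> /andP[? ?]; rewrite !ltW.
    have {}W2 : \forall h \near (0 : R), 0 <= h + t <= 1 := ct _ W2.
    apply: filterS2 W1 W2 => h H1 H2 h0.
    have H := H1 H2; rewrite addrK in H.
    have h0' : 0 < `|h| by rewrite normr_gt0.
    rewrite -(ler_pM2l h0') mulrC [leRHS]mulrC (le_trans _ H)//.
    rewrite -normrN -normrM /GRing.scale /= mulr1.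
    rewrite le_eqVlt; apply/orP; left; apply/eqP; congr `|_|.
    by field.
  by split; [apply/cvg_ex; exists (D t)|exact/cvg_lim].
(* Continuity on the closed interval: the expansion with constant 1 gives
   [|phi s - phi t| <= (1 + |D t|) * |s - t|]. *)
- apply/subspace_continuousP => t /=; rewrite in_itv /= => t01.
  apply/cvgrPdist_le => e e0; rewrite near_withinE.
  have d0 : 0 < 1 + `|D t| by rewrite ltr_pwDl.
  have W2 : \forall s \near t, `|t - s| <= e / (1 + `|D t|).
    exact/near_dist_le/divr_gt0.
  apply: filterS2 (Dphi t t01 1 ltr01) W2 => s /[swap].
  rewrite ler_pdivlMr ?ltr_pwDl// (distrC t) => H2 H1 s01.
  have {}H1 := H1 s01; rewrite mul1r in H1.
  apply: le_trans H2; rewrite -[leLHS]/(`|phi t - phi s|) (distrC (phi t)).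
  rewrite -[X in `|X|](subrK ((s - t) * D t)) (le_trans (ler_normD _ _))//.
  by rewrite mulrDr mulr1 normrM lerD.
Qed.

(* The mean value theorem is applied to f minus the quadratic K t^2 along the
   segment; applied to f alone it would lose the factor 1/2. *)
Lemma descent_lemma (X : set 'rV[R]_n) (f : 'rV[R]_n -> R)
    (g : 'rV[R]_n -> 'rV[R]_n) (L : R) :
  convex_set X -> is_gradient_on X f g -> 0 < L -> enorm_lipschitz_on X L g ->
  forall u v, X u -> X v ->
  f v <= f u + dot (g u) (v - u) + L / 2 * enorm (v - u) ^+ 2.
Proof.
move=> cX gX L0 lip u v Xu Xv.
pose K := L / 2 * enorm (v - u) ^+ 2.
have K0 : 0 <= K by rewrite mulr_ge0 ?exprn_ge0 ?enorm_ge0// divr_ge0// ltW.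
pose phi t := f (segment u v t) - K * t ^+ 2.
pose D t := dot (g (segment u v t)) (v - u) - 2 * K * t.
have [|c /andP[c0 c1]] := relative_MVT phi D.
  move=> t t01 e e0.
  have e20 : 0 < e / 2 by rewrite divr_gt0.
  have W1 := gradient_segment _ _ _ cX gX _ _ _ Xu Xv t01 _ e20.
  have K1 : 0 < 1 + K by rewrite ltr_pwDl.
  (* This close to [t], the remainder [K * (s - t) ^+ 2] of the quadratic uses at most half of
     [e]. *)
  have W2 : \forall s \near t, `|t - s| <= (e / 2) / (1 + K).
    exact/near_dist_le/divr_gt0.
  apply: filterS2 W1 W2 => s /[swap].
  rewrite ler_pdivlMr// (distrC t) => H2 H1 s01.
  have {}H1 := H1 s01.
  have -> : phi s - phi t - (s - t) * D t =
    (f (segment u v s) - f (segment u v t)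
      - (s - t) * dot (g (segment u v t)) (v - u)) - K * (s - t) ^+ 2.
    rewrite /phi /D; ring.
  rewrite (le_trans (ler_normB _ _))//.
  have -> : e * `|s - t| = e / 2 * `|s - t| + e / 2 * `|s - t| by field.
  apply: lerD => //.
  rewrite normrM (ger0_norm K0) normrX expr2 mulrA ler_wpM2r//.
  have := normr_ge0 (s - t); lra.
rewrite /phi /D segment0 segment1 expr1n expr0n /= mulr0 mulr1 subr0 => E.
have c01 : 0 <= c <= 1 by rewrite !ltW.
have Xc := convex_set_segment _ cX _ _ _ Xu Xv c01.
have Lc0 : 0 < L * c by rewrite mulr_gt0.
(* The gradient increment contributes at most [L * c * enorm (v - u) ^+ 2 = 2 * K * c], which
   cancels the derivative of the subtracted quadratic, so the unknown [c] disappears. *)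
have := dot_le_sqr (L * c) (g (segment u v c) - g u) (v - u) Lc0.
have -> : L * c * enorm (v - u) = L * enorm (segment u v c - u).
  by rewrite -{3}(segment0 u v) segmentB subr0 enormZ gtr0_norm// mulrA.
move=> /(_ (lip _ _ Xu Xc)); rewrite dotDl dotNl.
move: E; rewrite /K; lra.
Qed.

(** At a small [s > 0], convexity bounds the increment of [f] by [s * (f v - f u)], while the
    expansion at 0 bounds it below by [s * (dot (g u) (v - u) - e)]. Dividing by [s] leaves an error
    [e], which is arbitrary. *)
Lemma convex_gradient (X : set 'rV[R]_n) (f : 'rV[R]_n -> R)
    (g : 'rV[R]_n -> 'rV[R]_n) :
  convex_set X -> is_gradient_on X f g -> convex_function X f ->
  forall u v, X u -> X v -> f u + dot (g u) (v - u) <= f v.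
Proof.
move=> cX gX cf u v Xu Xv; apply/ler_addgt0Pr => e e0.
have t01 : 0 <= (0 : R) <= 1 by rewrite lexx ler01.
have W := gradient_segment _ _ _ cX gX _ _ _ Xu Xv t01 _ e0.
have [s [[s0 s1] H]] := @filter_ex _ (0 : R)^'+ _ _ (filterI (filterI
  (nbhs_right_gt _) (nbhs_right_le ltr01)) (cvg_within _ W)).
have s01 : 0 <= s <= 1 by rewrite (ltW s0).
move: (H s01); rewrite subr0 segment0 (gtr0_norm s0).
have := convex_function_segment _ _ cf _ _ _ Xu Xv s01.
move=> h1 /ler_normlP[h2 _]; rewrite -(ler_pM2l s0); lra.
Qed.

End Euclidean.

(** * Convergence rates of the UAG algorithm *)

Theorem corollary3 (R : realType) (n : nat) (X : set 'rV[R]_n)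
    (f : 'rV[R]_n -> R) (f' : 'rV[R]_n -> 'rV[R]_n) (h : 'rV[R]_n -> R)
    (L : R) (x0 : 'rV[R]_n) (alpha lam beta : nat -> R)
    (x xag xmd xtil xbar : nat -> 'rV[R]_n)
    (Psi := fun u : 'rV[R]_n => f u + h u)
    (X_closed : closed X)
    (X_convex : convex_set X)
    (f'_grad : is_gradient_on X f f')
    (h_convex : convex_function X h)
    (L_gt0 : 0 < L)
    (f'_lip : enorm_lipschitz_on X L f')
    (run : is_UAG X f f' h x0 alpha lam beta x xag xmd xtil xbar)
    (alphaE : forall k : nat, (1 <= k)%N -> alpha k = 2 / (k.+1)%:R)
    (lamE : forall k : nat, (1 <= k)%N -> lam k = k%:R / (2 * L))
    (betaE : forall k : nat, (1 <= k)%N -> beta k = 1 / L) :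
  (has_lbound [set Psi u | u in X] ->
   forall N : nat, (1 <= N)%N ->
   \big[Num.min/enorm (gen_proj_grad beta xag xbar 1) ^+ 2]_(1 <= k < N.+1)
      enorm (gen_proj_grad beta xag xbar k) ^+ 2
     <= 2 * L * (Psi x0 - inf [set Psi u | u in X]) / N%:R)
  /\
  (convex_function X f ->
   forall xstar : 'rV[R]_n, is_argmin X Psi xstar ->
   forall N : nat, (1 <= N)%N ->
   Psi (xag N) - Psi xstar
     <= 2 * L * enorm (x0 - xstar) ^+ 2 / (N%:R * (N.+1)%:R)).
Proof.
have descent := descent_lemma _ _ _ _ X_convex f'_grad L_gt0 f'_lip.
have Xx k : X (x k).
  case: k => [|k]; first by rewrite (uag_init run); exact: uag_x0_in run.
  by have [] := uag_x run (ltn0Sn k).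
have Xbar k : X (xbar k.+1) by have [] := uag_bar run (ltn0Sn k).
(* The upper bound is attained at [k = 0], where [alpha 1 = 1]. *)
have alpha01 k : 0 <= alpha k.+1 <= 1.
  by rewrite alphaE// divr_ge0//= ler_pdivrMr// mul1r ler_nat.
have Xag k : X (xag k).
  elim: k => [|k IH]; first by rewrite (uag_init_ag run); exact: uag_x0_in run.
  have [->//|->] := uag_choice run (ltn0Sn k).
  by rewrite (uag_til run)// -segmentE; exact: convex_set_segment.
have agLbar k : Psi (xag k.+1) <= Psi (xbar k.+1).
  by rewrite [leLHS](uag_choice_min run)// ge_min lexx.
have agLtil k : Psi (xag k.+1) <= Psi (xtil k.+1).
  by rewrite [leLHS](uag_choice_min run)// ge_min lexx orbT.
split.
- move=> lbPsi N N1.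
  have grad_decrease k : enorm (gen_proj_grad beta xag xbar k.+1) ^+ 2
      <= 2 * L * (Psi (xag k) - Psi (xag k.+1)).
    have gE : enorm (gen_proj_grad beta xag xbar k.+1) ^+ 2 =
        L ^+ 2 * enorm (xag k - xbar k.+1) ^+ 2.
      by rewrite /gen_proj_grad betaE// div1r invrK enormZ gtr0_norm// exprMn.
    have H1 := agLbar k.
    have H2 := descent _ _ (Xag k) (Xbar k).
    (* The comparison point is the prox center itself. The proximal step then gains two quadratics
       of coefficient [L / 2], of which [descent] consumes one. *)
    have := prox_three_point _ _ _ _ _ _ _ X_convex h_convex
      (uag_bar run (ltn0Sn k)) (Xag k).
    have cE : 1 / (2 * beta k.+1) = L / 2.
      by rewrite betaE//; field; rewrite gt_eqF.
    rewrite /prox_obj cE /= subrr => H3.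
    have enorm0 : enorm (0 : 'rV[R]_n) = 0.
      by rewrite -(scale0r 0) enormZ normr0 mul0r.
    rewrite dotDr dotNr enormB in H2; rewrite enormB enorm0 in H3.
    have H : L / 2 * enorm (xag k - xbar k.+1) ^+ 2
        <= Psi (xag k) - Psi (xag k.+1).
      by rewrite /Psi in H1 *; lra.
    by rewrite gE -(ler_pM2l L_gt0) in H *; lra.
  have sum_le m :
      \sum_(1 <= k < m.+1) enorm (gen_proj_grad beta xag xbar k) ^+ 2
      <= 2 * L * (Psi x0 - Psi (xag m)).
    elim: m => [|m IH].
      by rewrite big_geq// (uag_init_ag run) subrr mulr0.
    by rewrite big_nat_recr//=; have := grad_decrease m; move: IH; lra.
  (* As [N >= 1], the default value of the minimum is one of its terms. Below, [N] copies of [m] are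
     compared termwise with the telescoped sum. *)
  set m := \big[_/_]_(_ <= _ < _) _.
  rewrite ler_pdivlMr ?ltr0n//.
  have inf_le : inf [set Psi u | u in X] <= Psi (xag N).
    by apply: ge_inf => //; exists (xag N).
  apply: (@le_trans _ _ (2 * L * (Psi x0 - Psi (xag N)))); last first.
    by rewrite ler_pM2l ?mulr_gt0// lerD2l lerN2.
  apply: le_trans (sum_le N).
  have -> : m * N%:R = \sum_(1 <= k < N.+1) m.
    by rewrite sumr_const_nat subn1 mulr_natr.
  apply: ler_sum_nat => k kN.
  by apply: (bigmin_inf_seq _ k); rewrite ?mem_index_iota.
- move=> f_convex xs [Xs xs_min] N N1.
  have grad_le := convex_gradient _ _ _ X_convex f'_grad f_convex.
  pose D k := enorm (xs - x k) ^+ 2.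
  have potential_decrease k :
      k.+1%:R * k.+2%:R * (Psi (xag k.+1) - Psi xs) + 2 * L * D k.+1 <=
      k%:R * k.+1%:R * (Psi (xag k) - Psi xs) + 2 * L * D k.
    have mdE : xmd k.+1 = segment (xag k) (x k) (alpha k.+1).
      by rewrite (uag_md run)// -segmentE.
    have tilE : xtil k.+1 = segment (xag k) (x k.+1) (alpha k.+1).
      by rewrite (uag_til run)// -segmentE.
    have Xmd : X (xmd k.+1) by rewrite mdE; exact: convex_set_segment.
    have Xtil : X (xtil k.+1) by rewrite tilE; exact: convex_set_segment.
    have til_md : xtil k.+1 - xmd k.+1 = alpha k.+1 *: (x k.+1 - x k).
      by rewrite tilE mdE /segment opprD addrACA subrr add0r -scalerBr opprB
        addrA subrK.
    have H1 := agLtil k.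
    have H2 := descent _ _ Xmd Xtil.
    rewrite til_md enormZ exprMn real_normK ?num_real// -til_md in H2.
    (* The linear term splits with weights [1 - alpha] and [alpha]: the part at [xag k] is bounded
       by [H3]; the part at [x k.+1] is moved to [xs] by the proximal inequality [H6] and then
       bounded by [H4]. *)
    rewrite [X in dot _ (X - _)]tilE dot_segment in H2.
    have H3 := grad_le _ _ Xmd (Xag k).
    have H4 := grad_le _ _ Xmd Xs.
    have H5 := convex_function_segment _ _ h_convex _ _ _ (Xag k) (Xx k.+1)
      (alpha01 k).
    rewrite -tilE in H5.
    have := prox_three_point _ _ _ _ _ _ _ X_convex h_convex
      (uag_x run (ltn0Sn k)) Xs.
    rewrite /prox_obj /= -/(D k) -/(D k.+1) => H6.
    have /andP[a0 a1] := alpha01 k.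
    have {}a1 : 0 <= 1 - alpha k.+1 by rewrite subr_ge0.
    have {}H3 := ler_wpM2l a1 H3; have {}H4 := ler_wpM2l a0 H4.
    have {}H6 := ler_wpM2l a0 H6.
    rewrite !dotDr !dotNr in H2 H3 H4.
    have K0 : 0 <= k%:R :> R by [].
    have K1E : k.+1%:R = k%:R + 1 :> R by rewrite -natr1.
    have K2E : k.+2%:R = k%:R + 2 :> R by rewrite -addn2 natrD.
    (* Here [c = L / (k + 1)]. Multiplication by [(k + 1) * (k + 2)] makes the distance coefficient
       independent of [k] ([acE]) and turns the weight of the previous gap into [k * (k + 1)]
       ([aE]). *)
    pose c := 1 / (2 * lam k.+1).
    have acE : (k%:R + 1) * (k%:R + 2) * (alpha k.+1 * c) = 2 * L.
      rewrite /c alphaE// lamE// K1E K2E; field.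
      by rewrite !gt_eqF//; lra.
    have aE : (k%:R + 1) * (k%:R + 2) * (1 - alpha k.+1) = k%:R * (k%:R + 1).
      by rewrite alphaE// K2E; field; rewrite gt_eqF//; lra.
    (* The proximal quadratic in [x k.+1 - x k] dominates the one from [descent]: [2L/((k+1)(k+2))]
       against [2L/(k+2)^2]. *)
    have aLE : L / 2 * alpha k.+1 ^+ 2 <= alpha k.+1 * c.
      have -> : alpha k.+1 * c = L / 2 * alpha k.+1 ^+ 2
          + 2 * L / ((k%:R + 1) * (k%:R + 2) ^+ 2).
        rewrite /c alphaE// lamE// K1E K2E; field.
        by rewrite !gt_eqF//; lra.
      by rewrite lerDl divr_ge0 ?mulr_ge0 ?exprn_ge0 ?addr_ge0// ltW.
    have {}aLE := ler_wpM2r (sqr_ge0 (enorm (x k.+1 - x k))) aLE.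
    have HP : Psi (xag k.+1) - Psi xs <=
        (1 - alpha k.+1) * (Psi (xag k) - Psi xs)
        + alpha k.+1 * c * (D k - D k.+1).
      by rewrite /Psi in H1 *; rewrite -/c in H6; lra.
    have K12 : 0 <= (k%:R + 1) * (k%:R + 2) :> R by rewrite mulr_ge0// addr_ge0.
    have := ler_wpM2l K12 HP.
    rewrite [leRHS]mulrDr (mulrA _ (1 - _)) aE (mulrA _ (alpha _ * c)) acE.
    by rewrite K1E K2E; lra.
  have potential_le m :
      m%:R * m.+1%:R * (Psi (xag m) - Psi xs) + 2 * L * D m <= 2 * L * D 0%N.
    (* At index 0 the weight of [Psi x0 - Psi xs] vanishes, so only the initial distance remains in
       the bound. *)
    elim: m => [|m IH]; first by rewrite !mul0r add0r.
    exact: le_trans (potential_decrease m) IH.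
  rewrite ler_pdivlMr ?mulr_gt0 ?ltr0n//.
  have := potential_le N.
  rewrite /D (uag_init run) (enormB xs x0).
  have : 0 <= 2 * L * enorm (xs - x N) ^+ 2.
    by rewrite mulr_ge0 ?sqr_ge0// mulr_ge0// ltW.
  lra.
Qed.
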